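(* The noise constrained minimization problem $$\min_{x\in\mathbb{R}^n}\tfrac12\|x\|_{N^{-1}}^2\quad\text{s.t.}\quad \tfrac12\|Ax-b\|_{M^{-1}}^2\le \tfrac{\tau m}{2}$$ has a unique solution $x^*$, and it satisfies $\|Ax^*-b\|_{M^{-1}}^2=\tau m$. Furthermore, there is a unique $\lambda^*>0$ which is the Lagrangian multiplier corresponding to $x^*$ in the Lagrangian $$\mathcal{L}(x,\lambda)=\tfrac12\|x\|_{N^{-1}}^2+\tfrac{\lambda}{2}\left(\|Ax-b\|_{M^{-1}}^2-\tau m\right),\quad \lambda\ge 0.$$
   Context: Let $m,n\ge1$, $A\in\mathbb{R}^{m\times n}$, $b\in\mathbb{R}^m$, and let $M\in\mathbb{R}^{m\times m}$, $N\in\mathbb{R}^{n\times n}$ be symmetric positive definite. For a symmetric positive definite matrix $B$, $\|x\|_B=(x^\top Bx)^{1/2}$. The real parameter $\tau>1$ is fixed (chosen marginally greater than $1$). Standing assumption: for every minimizer $x$ of $\|Ax-b\|_{M^{-1}}$ over $\mathbb{R}^n$ one has $\|Ax-b\|_{M^{-1}}^2<\tau m<\|b\|_{M^{-1}}^2$. A number $\lambda^*$ is a Lagrangian multiplier corresponding to $x^*$ if $(x^*,\lambda^* )$ satisfies the KKT conditions: $N^{-1}x^*+\lambda^*A^\top M^{-1}(Ax^*-b)=0$, $\lambda^*\left(\|Ax^*-b\|_{M^{-1}}^2-\tau m\right)=0$, $\lambda^*\ge0$. *)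

(* Defs.v *)
From mathcomp Require Import all_boot all_order all_algebra.
From mathcomp Require Import classical_sets reals ring.

Set Implicit Arguments.
Unset Strict Implicit.
Unset Printing Implicit Defensive.

Import Order.TTheory GRing.Theory Num.Theory.

Local Open Scope classical_set_scope.
Local Open Scope ring_scope.

Definition sym_posdef (R : realType) (k : nat) (B : 'M[R]_k) : Prop :=
  B^T = B /\ forall x : 'cV[R]_k, x != 0 -> 0 < (x^T *m B *m x) 0 0.

Definition wnorm (R : realType) (k : nat) (B : 'M[R]_k) (x : 'cV[R]_k) : R :=
  Num.sqrt ((x^T *m B *m x) 0 0).

Definition is_minimizer (R : realType) (T : Type) (S : set T) (f : T -> R)
    (x : T) : Prop :=
  S x /\ forall y, S y -> f x <= f y.

Section NoiseConstrained.

Variables (R : realType) (m n : nat).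
Variables (A : 'M[R]_(m, n)) (b : 'cV[R]_m) (M : 'M[R]_m) (N : 'M[R]_n).
Variable tau : R.

Definition misfit (x : 'cV[R]_n) : R := wnorm (invmx M) (A *m x - b).

Definition objective (x : 'cV[R]_n) : R := 2^-1 * wnorm (invmx N) x ^+ 2.

Definition feasible : set 'cV[R]_n :=
  [set x | 2^-1 * misfit x ^+ 2 <= tau * m%:R / 2].

Definition is_solution (x : 'cV[R]_n) : Prop :=
  is_minimizer feasible objective x.

Definition lagrangian (x : 'cV[R]_n) (lambda : R) : R :=
  2^-1 * wnorm (invmx N) x ^+ 2
  + lambda / 2 * (misfit x ^+ 2 - tau * m%:R).

Definition lagrangian_grad (x : 'cV[R]_n) (lambda : R) : 'cV[R]_n :=
  invmx N *m x + lambda *: (A^T *m invmx M *m (A *m x - b)).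

(* Primal feasibility is not listed: a multiplier is only attached to a point
   that is already known to solve the problem. *)
Definition is_lagrange_multiplier (x : 'cV[R]_n) (lambda : R) : Prop :=
  [/\ lagrangian_grad x lambda = 0,
      lambda * (misfit x ^+ 2 - tau * m%:R) = 0
    & 0 <= lambda].

End NoiseConstrained.

Lemma sym_posdef_unitmx (R : realType) (k : nat) (B : 'M[R]_k) :
  sym_posdef B -> B \in unitmx.
Proof.
case=> _ pB; rewrite -unitmx_tr -row_free_unit -kermx_eq0; apply/negP=> /negP.
move=> /rowV0Pn [v /sub_kermxP vB v0].
have := pB v^T; rewrite trmxK -trmx_eq0 trmxK => /(_ v0).
by rewrite -(trmxK B) -mulmxA -trmx_mul vB trmx0 mulmx0 mxE ltxx.
Qed.

Lemma sym_posdef_invmx (R : realType) (k : nat) (B : 'M[R]_k) :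
  sym_posdef B -> sym_posdef (invmx B).
Proof.
move=> hB; have uB := sym_posdef_unitmx hB; have [sB pB] := hB.
have sV : (invmx B)^T = invmx B by rewrite trmx_inv sB.
split=> // x x0; have := pB (invmx B *m x).
rewrite trmx_mul sV mulmxA mulmxKV // -mulmxA; apply.
by apply: contraNneq x0 => e; rewrite -(mulKVmx uB x) e mulmx0.
Qed.

Lemma wnorm_sq (R : realType) (k : nat) (B : 'M[R]_k) (x : 'cV[R]_k) :
  sym_posdef B -> wnorm B x ^+ 2 = (x^T *m B *m x) 0 0.
Proof.
case=> _ pB; rewrite /wnorm sqr_sqrtr //.
by have [->|/pB/ltW //] := eqVneq x 0; rewrite mulmx0 mxE.
Qed.

Lemma wnorm_sqD (R : realType) (k : nat) (B : 'M[R]_k) (x d : 'cV[R]_k) :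
  sym_posdef B ->
  wnorm B (x + d) ^+ 2
    = wnorm B x ^+ 2 + 2 * (d^T *m B *m x) 0 0 + wnorm B d ^+ 2.
Proof.
move=> hB; rewrite !wnorm_sq //.
have -> : (x + d)^T = x^T + d^T by exact: linearD.
rewrite !mulmxDl !mulmxDr.
have -> : x^T *m B *m d = d^T *m B *m x.
  rewrite [LHS]mx11_scalar -tr_scalar_mx -mx11_scalar.
  by rewrite !trmx_mul trmxK mulmxA (proj1 hB).
by rewrite !mxE; ring.
Qed.

(* The first-order term shows that [lagrangian_grad] is the gradient of the
   Lagrangian in its first argument. *)
Lemma lagrangianD (R : realType) (m n : nat) (A : 'M[R]_(m, n)) (b : 'cV[R]_m)
    (M : 'M[R]_m) (N : 'M[R]_n) (tau lambda : R) (x d : 'cV[R]_n) :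
  sym_posdef M -> sym_posdef N ->
  lagrangian A b M N tau (x + d) lambda
    = lagrangian A b M N tau x lambda
      + (d^T *m lagrangian_grad A b M N x lambda) 0 0
      + 2^-1 * (wnorm (invmx N) d ^+ 2
                + lambda * wnorm (invmx M) (A *m d) ^+ 2).
Proof.
move=> /sym_posdef_invmx hM /sym_posdef_invmx hN.
rewrite /lagrangian /misfit /lagrangian_grad.
have -> : A *m (x + d) - b = (A *m x - b) + A *m d.
  by rewrite [A *m (x + d)]mulmxDr addrAC.
move: (A *m x - b) => r.
rewrite (wnorm_sqD x d hN) (wnorm_sqD r (A *m d) hM).
have -> : d^T *m (invmx N *m x + lambda *: (A^T *m invmx M *m r))
    = d^T *m invmx N *m x + lambda *: ((A *m d)^T *m invmx M *m r).
  by rewrite mulmxDr -scalemxAr trmx_mul !mulmxA.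
set e := _ *m r; set f := d^T *m _ *m x.
have -> : (f + lambda *: e) 0 0 = f 0 0 + lambda * e 0 0 by rewrite !mxE.
move: (wnorm _ x) (wnorm _ d) (wnorm _ r) (wnorm _ (A *m d)) => p q s t.
move: (f 0 0) (e 0 0) => u v.
by field.
Qed.

(* Main.v *)
Require Import Defs.
From mathcomp Require Import all_boot all_order all_algebra.
From mathcomp Require Import classical_sets reals.
From mathcomp Require Import ring lra.

Set Implicit Arguments.
Unset Strict Implicit.
Unset Printing Implicit Defensive.

Import Order.TTheory GRing.Theory Num.Theory.
Local Open Scope classical_set_scope.
Local Open Scope ring_scope.

(** For [lambda >= 0] the Lagrangian is strictly convex in [x], with a unique
    stationary point [tikhonov lambda]. Its squared misfit is a rational
    function of [lambda] without poles on [lambda >= 0]; it equals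
    [|b|^2 > tau m] at [0], and drops below [tau m] for large [lambda] because
    [tikhonov lambda] does at least as well as a least-squares solution [x0] in
    the Lagrangian, so that the squared misfit is at most
    [misfit x0 ^ 2 + |x0|^2 / lambda]. The intermediate value theorem for
    polynomials yields [lambda > 0] with squared misfit exactly [tau m], and
    strict convexity of the Lagrangian makes [tikhonov lambda] the only
    solution. Two multipliers for the same [x] would force
    [A^T M^-1 (A x - b) = 0], hence [x = 0] and [|b|^2 = tau m]. *)

Lemma sym_posdef_quad_ge0 (R : realType) (k : nat) (B : 'M[R]_k) (x : 'cV[R]_k) :
  sym_posdef B -> 0 <= (x^T *m B *m x) 0 0.
Proof. by move=> hB; rewrite -wnorm_sq // sqr_ge0. Qed.

Lemma sym_posdef_wnorm_eq0 (R : realType) (k : nat) (B : 'M[R]_k) (x : 'cV[R]_k) :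
  sym_posdef B -> wnorm B x ^+ 2 = 0 -> x = 0.
Proof.
move=> hB; rewrite wnorm_sq // => e; apply/eqP/negP => /negP x0.
by have := proj2 hB _ x0; rewrite e ltxx.
Qed.

(** Strict positivity comes from [Q]: the Gram term is only semidefinite, since [A] may have a
    kernel. *)
Lemma sym_posdefD_gram (R : realType) (m n : nat) (A : 'M[R]_(m, n))
    (P : 'M[R]_m) (Q : 'M[R]_n) (t : R) :
  sym_posdef P -> sym_posdef Q -> 0 <= t ->
  sym_posdef (Q + t *: (A^T *m P *m A)).
Proof.
move=> hP hQ t0; split=> [|x x0].
  rewrite linearD linearZ /= !trmx_mul trmxK (proj1 hP) (proj1 hQ).
  by rewrite mulmxA.
rewrite mulmxDr mulmxDl -scalemxAr -scalemxAl mxE.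
rewrite ltr_pwDl ?(proj2 hQ) // mxE mulr_ge0 //.
have := sym_posdef_quad_ge0 (A *m x) hP.
by rewrite trmx_mul !mulmxA.
Qed.

Lemma misfit0 (R : realType) (m n : nat) (A : 'M[R]_(m, n)) (b : 'cV[R]_m)
    (M : 'M[R]_m) :
  misfit A b M 0 = wnorm (invmx M) b.
Proof.
rewrite /misfit mulmx0 sub0r /wnorm.
have -> : (- b)^T = - b^T by exact: linearN.
by rewrite mulmxN !mulNmx opprK.
Qed.

(** If [G *m K = 0], each column [v] of [K] makes the [P]-form vanish at [A *m v], so [A *m v = 0]
    by definiteness. Hence the cokernel of [G] annihilates [A], whatever the rank of [A]. *)
Lemma submx_gram (R : realType) (m n : nat) (A : 'M[R]_(m, n)) (P : 'M[R]_m) :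
  sym_posdef P -> (A <= A^T *m P *m A)%MS.
Proof.
move=> hP; set G := A^T *m P *m A; rewrite submxE.
have := mulmx_coker G; move: (cokermx G) => K GK0.
apply/eqP/matrixP => i j; rewrite [RHS]mxE.
suff : col j (A *m K) = 0 by move/colP/(_ i); rewrite !mxE.
apply: (@sym_posdef_wnorm_eq0 _ _ P) => //; rewrite wnorm_sq // colE.
move: (delta_mx j 0 : 'cV_n) => d.
have -> : (A *m K *m d)^T *m P *m (A *m K *m d) = (K *m d)^T *m (G *m K) *m d.
  by rewrite !trmx_mul /G !mulmxA.
by rewrite GK0 mulmx0 mul0mx mxE.
Qed.

Lemma normal_equation_solvable (R : realType) (m n : nat) (A : 'M[R]_(m, n))
    (P : 'M[R]_m) (b : 'cV[R]_m) :
  sym_posdef P -> exists x : 'cV[R]_n, A^T *m P *m (A *m x - b) = 0.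
Proof.
move=> hP.
(* The transposed normal equation, posed as membership in a row space. *)
have /submxP [y hy] : (b^T *m P *m A <= A^T *m P *m A)%MS.
  by apply: submx_trans (submx_gram A hP); exact: submxMl.
exists y^T; apply: trmx_inj; rewrite trmx0 !trmx_mul linearB /= trmx_mul !trmxK.
by rewrite (proj1 hP) mulmxBl !mulmxA hy !mulmxA subrr.
Qed.

(** The noise assumption speaks only of minimizers; one must exist before it yields any
    inequality. *)
Lemma least_squares_exists (R : realType) (m n : nat) (A : 'M[R]_(m, n))
    (b : 'cV[R]_m) (M : 'M[R]_m) :
  sym_posdef M -> exists x, is_minimizer setT (misfit A b M) x.
Proof.
move=> /sym_posdef_invmx hP.
have [x hx] := normal_equation_solvable A b hP.
exists x; split=> // y _.
rewrite -(@ler_pXn2r _ 2) // ?nnegrE ?sqrtr_ge0 //.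
rewrite /misfit -(subrK x y); move: (y - x) => d.
have -> : A *m (d + x) - b = (A *m x - b) + A *m d.
  by rewrite mulmxDr -addrA addrC.
(* The normal equation kills the cross term. *)
rewrite (wnorm_sqD _ (A *m d) hP) trmx_mul -(mulmxA d^T) -mulmxA hx.
by rewrite !(mulmx0, mxE) mulr0 addr0 lerDl sqr_ge0.
Qed.

(** The Hessian in [x] of the Lagrangian with multiplier [t]. *)
Definition tikhonov_mx (R : realType) (m n : nat) (A : 'M[R]_(m, n))
    (M : 'M[R]_m) (N : 'M[R]_n) (t : R) : 'M[R]_n :=
  invmx N + t *: (A^T *m invmx M *m A).

Definition tikhonov (R : realType) (m n : nat) (A : 'M[R]_(m, n))
    (b : 'cV[R]_m) (M : 'M[R]_m) (N : 'M[R]_n) (t : R) : 'cV[R]_n :=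
  invmx (tikhonov_mx A M N t) *m (t *: (A^T *m invmx M *m b)).

Lemma tikhonov_mx_unit (R : realType) (m n : nat) (A : 'M[R]_(m, n))
    (M : 'M[R]_m) (N : 'M[R]_n) (t : R) :
  sym_posdef M -> sym_posdef N -> 0 <= t -> tikhonov_mx A M N t \in unitmx.
Proof.
move=> /sym_posdef_invmx hM /sym_posdef_invmx hN t0.
exact/sym_posdef_unitmx/sym_posdefD_gram.
Qed.

Lemma tikhonov_stationary (R : realType) (m n : nat) (A : 'M[R]_(m, n))
    (b : 'cV[R]_m) (M : 'M[R]_m) (N : 'M[R]_n) (t : R) :
  sym_posdef M -> sym_posdef N -> 0 <= t ->
  lagrangian_grad A b M N (tikhonov A b M N t) t = 0.
Proof.
move=> hM hN t0.
have := mulKVmx (tikhonov_mx_unit A hM hN t0) (t *: (A^T *m invmx M *m b)).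
rewrite -/(tikhonov A b M N t); move: (tikhonov A b M N t) => x hx.
rewrite /lagrangian_grad mulmxBr scalerBr -hx mulmxDl -scalemxAl mulmxA addrA.
by rewrite subrr.
Qed.

(* Cramer's rule: multiplying by the squared determinant clears denominators. *)
Lemma tikhonov_misfit_poly (R : realType) (m n : nat) (A : 'M[R]_(m, n))
    (b : 'cV[R]_m) (M : 'M[R]_m) (N : 'M[R]_n) (c : R) :
  sym_posdef M -> sym_posdef N ->
  exists p : {poly R}, forall t, 0 <= t ->
    p.[t] = \det (tikhonov_mx A M N t) ^+ 2
            * (misfit A b M (tikhonov A b M N t) ^+ 2 - c).
Proof.
move=> hM hN; have hP := sym_posdef_invmx hM.
pose C k l (B : 'M[R]_(k, l)) := map_mx (@polyC R) B.
pose B := C _ _ (invmx N) + 'X *: C _ _ (A^T *m invmx M *m A).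
(* The residual scaled by [\det B]: the adjugate replaces the inverse, so entries stay
   polynomial. *)
pose r := C _ _ A *m (\adj B *m ('X *: C _ _ (A^T *m invmx M *m b)))
          - \det B *: C _ _ b.
exists ((r^T *m C _ _ (invmx M) *m r) 0 0 - c%:P * \det B ^+ 2) => t t0.
(* Evaluation at [t] is a ring morphism, so it commutes with products, determinants and
   adjugates. *)
pose ev : {rmorphism {poly R} -> R} := horner_eval t.
have evC k l (D : 'M[R]_(k, l)) : map_mx ev (C _ _ D) = D.
  by apply/matrixP=> i j; rewrite !mxE /ev /= /horner_eval hornerC.
have evX : ev 'X = t by rewrite /ev /= /horner_eval hornerX.
have evB : map_mx ev B = tikhonov_mx A M N t.
  by rewrite map_mxD map_mxZ !evC evX.
have evD : ev (\det B) = \det (tikhonov_mx A M N t).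
  by rewrite -evB -det_map_mx.
have uT := tikhonov_mx_unit A hM hN t0.
have uD : \det (tikhonov_mx A M N t) \is a GRing.unit by rewrite -unitmxE.
have evr : map_mx ev r =
    \det (tikhonov_mx A M N t) *: (A *m tikhonov A b M N t - b).
  rewrite map_mxB !map_mxM !map_mxZ map_mx_adj evB evX !evC evD.
  rewrite /tikhonov /invmx uT scalerBr -scalemxAl -(scalemxAr _ A).
  by rewrite (scalerA (\det _)) mulrV // scale1r.
rewrite -[LHS]/(ev _) rmorphB rmorphM rmorphXn /= evD.
have -> : ev c%:P = c by rewrite /ev /= /horner_eval hornerC.
have -> : ev ((r^T *m C _ _ (invmx M) *m r) 0 0)
    = ((map_mx ev r)^T *m invmx M *m map_mx ev r) 0 0.
  have -> : (map_mx ev r)^T *m invmx M *m map_mx ev r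
      = map_mx ev (r^T *m C _ _ (invmx M) *m r).
    by rewrite !map_mxM map_trmx evC.
  by rewrite [RHS]mxE.
rewrite evr /misfit wnorm_sq //; move: (A *m _ - b) (\det _) => v d.
have -> : (d *: v)^T = d *: v^T by exact: linearZ.
rewrite -!scalemxAl -scalemxAr mxE [X in d * X - _]mxE.
by ring.
Qed.

(** The second-order expansion of the Lagrangian has no linear term at a stationary point; the part
    of its quadratic term coming from [A] is nonnegative and is dropped. *)
Lemma lagrangian_stationary_ge (R : realType) (m n : nat) (A : 'M[R]_(m, n))
    (b : 'cV[R]_m) (M : 'M[R]_m) (N : 'M[R]_n) (tau t : R) (x y : 'cV[R]_n) :
  sym_posdef M -> sym_posdef N -> 0 <= t -> lagrangian_grad A b M N x t = 0 ->
  lagrangian A b M N tau x t + 2^-1 * wnorm (invmx N) (y - x) ^+ 2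
    <= lagrangian A b M N tau y t.
Proof.
move=> hM hN t0 hx; rewrite -{2}(subrK x y) [_ + x]addrC lagrangianD // hx.
rewrite mulmx0 mxE addr0 lerD2l ler_wpM2l ?invr_ge0 //.
by rewrite lerDl mulr_ge0 // sqr_ge0.
Qed.

Lemma discrepancy_multiplier_exists (R : realType) (m n : nat)
    (A : 'M[R]_(m, n)) (b : 'cV[R]_m) (M : 'M[R]_m) (N : 'M[R]_n) (c : R)
    (x0 : 'cV[R]_n) :
  sym_posdef M -> sym_posdef N ->
  misfit A b M x0 ^+ 2 < c -> c < wnorm (invmx M) b ^+ 2 ->
  exists2 t, 0 < t & misfit A b M (tikhonov A b M N t) ^+ 2 = c.
Proof.
move=> hM hN lt_x0c lt_cb.
have [p hp] := tikhonov_misfit_poly A b c hM hN.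
have det_gt0 t : 0 <= t -> 0 < \det (tikhonov_mx A M N t) ^+ 2.
  move=> t0; rewrite exprn_even_gt0 //= -unitfE -unitmxE.
  exact: tikhonov_mx_unit.
have tikhonov0 : misfit A b M (tikhonov A b M N 0) ^+ 2 = wnorm (invmx M) b ^+ 2.
  by rewrite /tikhonov scale0r mulmx0 misfit0.
pose u := wnorm (invmx N) x0 ^+ 2; have u0 : 0 <= u by exact: sqr_ge0.
pose d := c - misfit A b M x0 ^+ 2; have d0 : 0 < d by rewrite subr_gt0.
(* Chosen so that [u / t1 < d], which pushes the bound on the squared misfit below [c]. *)
pose t1 := (u + 1) / d; have t1_gt0 : 0 < t1 by rewrite divr_gt0 // ltr_wpDl.
have misfit1 : misfit A b M (tikhonov A b M N t1) ^+ 2 < c.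
  have st := tikhonov_stationary A b hM hN (ltW t1_gt0).
  (* The noise level only shifts the Lagrangian by a constant for fixed [t1], so it is set to
     [0]. *)
  have := lagrangian_stationary_ge 0 x0 hM hN (ltW t1_gt0) st.
  rewrite /lagrangian mul0r subr0 -/u.
  have w0 := sqr_ge0 (wnorm (invmx N) (tikhonov A b M N t1)).
  have w1 := sqr_ge0 (wnorm (invmx N) (x0 - tikhonov A b M N t1)).
  have t1d : t1 * c - t1 * misfit A b M x0 ^+ 2 = u + 1.
    by rewrite -mulrBr -/d divfK // gt_eqF.
  move=> le; rewrite -(ltr_pM2l t1_gt0); lra.
(* [p] goes from positive to negative, while the theorem wants a rise through zero; hence [- p]. *)
have [||t /andP [t0 _] /rootP] := @poly_ivt _ (- p) 0 t1.
- exact: ltW.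
- rewrite !hornerN !hp ?(ltW t1_gt0) // tikhonov0 oppr_le0 oppr_ge0.
  rewrite pmulr_rge0 ?pmulr_rle0 ?det_gt0 ?(ltW t1_gt0) //.
  by rewrite subr_ge0 subr_le0 !ltW.
rewrite hornerN hp // => /eqP; rewrite oppr_eq0 mulf_eq0 gt_eqF ?det_gt0 //=.
rewrite subr_eq0 => /eqP ht; exists t => //.
rewrite lt_neqAle t0 andbT; apply/eqP => t_eq0.
by move: ht lt_cb; rewrite -t_eq0 tikhonov0 => ->; rewrite ltxx.
Qed.

(** The multiplier term vanishes at [x] by slackness and is nonpositive at feasible [y], so the
    Lagrangian bound passes to the objective. Its quadratic gap forces uniqueness. *)
Lemma lagrange_multiplier_solution (R : realType) (m n : nat)
    (A : 'M[R]_(m, n)) (b : 'cV[R]_m) (M : 'M[R]_m) (N : 'M[R]_n)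
    (tau t : R) (x : 'cV[R]_n) :
  sym_posdef M -> sym_posdef N -> feasible A b M tau x ->
  is_lagrange_multiplier A b M N tau x t ->
  unique (is_solution A b M N tau) x.
Proof.
move=> hM hN fx [hx slack t0].
have gap y : feasible A b M tau y ->
    objective N x + 2^-1 * wnorm (invmx N) (y - x) ^+ 2 <= objective N y.
  move=> fy; have := lagrangian_stationary_ge tau y hM hN t0 hx.
  have : t * (misfit A b M y ^+ 2 - tau * m%:R) <= 0.
    by rewrite mulr_ge0_le0 //; move: fy; rewrite /feasible /=; lra.
  by rewrite /lagrangian /objective; lra.
split.
  split=> // y /gap; have := sqr_ge0 (wnorm (invmx N) (y - x)); lra.
move=> y [fy ymin]; have le_yx := ymin x fx; have := gap y fy.
have w0 := sqr_ge0 (wnorm (invmx N) (y - x)) => le_xy.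
apply/esym/subr0_eq/(sym_posdef_wnorm_eq0 (sym_posdef_invmx hN)); lra.
Qed.

Lemma lagrange_multiplier_uniq (R : realType) (m n : nat)
    (A : 'M[R]_(m, n)) (b : 'cV[R]_m) (M : 'M[R]_m) (N : 'M[R]_n)
    (s t : R) (x : 'cV[R]_n) :
  sym_posdef N -> x != 0 ->
  lagrangian_grad A b M N x s = 0 -> lagrangian_grad A b M N x t = 0 -> s = t.
Proof.
move=> hN x0 hs ht; apply/eqP; rewrite -subr_eq0.
apply: contraNT x0 => st0.
have /eqP : (s - t) *: (A^T *m invmx M *m (A *m x - b)) = 0.
  rewrite scalerBl; apply/eqP; rewrite subr_eq0; apply/eqP.
  by apply: (@addrI _ (invmx N *m x)); rewrite -/(lagrangian_grad _ _ _ _ _ _) hs.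
rewrite scaler_eq0 (negPf st0) /= => /eqP g0.
move: hs; rewrite /lagrangian_grad g0 scaler0 addr0 => Nx0.
by rewrite -(mulKVmx (sym_posdef_unitmx hN) x) Nx0 mulmx0.
Qed.

Theorem theorem2p1 (R : realType) (m n : nat) (hm : (1 <= m)%N) (hn : (1 <= n)%N)
    (A : 'M[R]_(m, n)) (b : 'cV[R]_m) (M : 'M[R]_m) (N : 'M[R]_n)
    (hM : sym_posdef M) (hN : sym_posdef N)
    (tau : R) (htau : 1 < tau)
    (hnoise : forall x : 'cV[R]_n, is_minimizer setT (misfit A b M) x ->
       misfit A b M x ^+ 2 < tau * m%:R /\
       tau * m%:R < wnorm (invmx M) b ^+ 2) :
  exists x : 'cV[R]_n,
    [/\ unique (is_solution A b M N tau) x,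
        misfit A b M x ^+ 2 = tau * m%:R
      & exists lambda : R,
          0 < lambda /\ unique (is_lagrange_multiplier A b M N tau x) lambda].
Proof.
have [x0 /hnoise [lt_x0 lt_b]] := least_squares_exists A b hM.
have [t t_gt0 ht] := discrepancy_multiplier_exists hM hN lt_x0 lt_b.
have st := tikhonov_stationary A b hM hN (ltW t_gt0).
set x := tikhonov A b M N t in ht st *.
have mult : is_lagrange_multiplier A b M N tau x t.
  by split=> //; [rewrite ht subrr mulr0 | exact: ltW].
exists x; split=> //.
  by apply: (lagrange_multiplier_solution hM hN _ mult); rewrite /feasible /= ht mulrC.
exists t; split=> //; split=> // s [hs _ _].
apply: (lagrange_multiplier_uniq hN _ st hs).
(* At [x = 0] the squared misfit would be that of [b], which exceeds the noise level. *)
by apply: contraTneq lt_b => x_eq0; rewrite -ht x_eq0 misfit0 ltxx.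
Qed.
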